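(* Let $t\geq 1$ be an integer. Then there exists $n_0=n_0(t)$ such that for every $n\geq n_0$ and every $Q_t$-minor-free graph $G$ of order $n$, $$q(G)\leq q(K_t\vee M_{n-t}),$$ with equality if and only if $G=K_t\vee M_{n-t}$ (up to isomorphism).
   Context: All graphs are finite, simple and undirected; the order of a graph is its number of vertices. For a graph $G$, $A(G)$ is its adjacency matrix, $D(G)$ is the diagonal matrix of its vertex degrees, $D(G)+A(G)$ is its signless Laplacian matrix, and $q(G)$, the signless Laplacian spectral radius, is the largest eigenvalue of $D(G)+A(G)$. $K_n$ is the complete graph on $n$ vertices, and $G\vee H$ is the join of vertex-disjoint graphs $G$ and $H$, obtained from their disjoint union by joining every vertex of $G$ to every vertex of $H$. $M_{n-t}$ is the graph on $n-t$ vertices whose edge set consists of $\lfloor\frac{n-t}{2}\rfloor$ pairwise disjoint edges (so there is one isolated vertex if $n-t$ is odd, and none otherwise). $Q_t$ is the graph obtained from $t$ quadrangles (cycles of length $4$) by sharing one common vertex, the quadrangles being otherwise vertex-disjoint; it has $3t+1$ vertices and $4t$ edges. A graph $H$ is a minor of $G$ if $H$ can be obtained from a subgraph of $G$ by contracting edges; $G$ is $H$-minor-free if $H$ is not a minor of $G$. *)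

(* Defs.v *)
From HB Require Import structures.
From mathcomp Require Import all_boot all_order all_algebra.
From mathcomp Require Import classical_sets reals.
From mathcomp Require Import complex.

Set Implicit Arguments.
Unset Strict Implicit.
Unset Printing Implicit Defensive.

Import Order.TTheory GRing.Theory Num.Theory.
Local Open Scope ring_scope.

Record sgraph := SGraph {
  vertex :> finType;
  adj : rel vertex;
  adj_sym : symmetric adj;
  adj_irrefl : irreflexive adj
}.

Definition giso (G H : sgraph) : Prop :=
  exists2 f : G -> H, bijective f & forall u v, adj (f u) (f v) = adj u v.

(* [S] is, up to renaming its vertices, a subgraph of [G] (not necessarily
   induced). *)
Definition subgraph (S G : sgraph) : Prop :=
  exists2 f : S -> G, injective f & forall u v, adj u v -> adj (f u) (f v).

Section Contraction.
Variables (G : sgraph) (x y : G).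

(* Contracting the edge [xy] removes [y]; the remaining vertex [x] stands for
   the merged pair. *)
Definition merge_end (v : G) : G := if v == y then x else v.

Definition contract_adj : rel {v : G | v != y} := fun u v =>
  (u != v) && [exists u', exists v',
    [&& merge_end u' == val u, merge_end v' == val v & adj u' v']].

Fact contract_sym : symmetric contract_adj.
Proof.
move=> u v; rewrite /contract_adj eq_sym; congr (_ && _).
by apply/existsP/existsP => -[a /existsP[b /and3P[ab bu e]]]; exists b;
  apply/existsP; exists a; rewrite ab bu adj_sym.
Qed.

Fact contract_irrefl : irreflexive contract_adj.
Proof. by move=> u; rewrite /contract_adj eqxx. Qed.

Definition contract : sgraph := SGraph contract_sym contract_irrefl.

End Contraction.

Inductive contracts_to : sgraph -> sgraph -> Prop :=
| contracts_iso (G H : sgraph) : giso G H -> contracts_to G H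
| contracts_edge (G H : sgraph) (x y : G) :
    adj x y -> contracts_to (contract x y) H -> contracts_to G H.

Definition minor (H G : sgraph) : Prop :=
  exists2 S : sgraph, subgraph S G & contracts_to S H.

Definition minor_free (H G : sgraph) : Prop := ~ minor H G.

Section Constructions.

Definition complete_adj n : rel 'I_n := fun i j => i != j.

Fact complete_sym n : symmetric (@complete_adj n).
Proof. by move=> i j; rewrite /complete_adj eq_sym. Qed.

Fact complete_irrefl n : irreflexive (@complete_adj n).
Proof. by move=> i; rewrite /complete_adj eqxx. Qed.

Definition complete n : sgraph := SGraph (@complete_sym n) (@complete_irrefl n).

(* The edges are {0,1}, {2,3}, ...; when [m] is odd, [m.-1] is isolated. *)
Definition matching_adj m : rel 'I_m := fun i j => (i != j) && (i./2 == j./2).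

Fact matching_sym m : symmetric (@matching_adj m).
Proof. by move=> i j; rewrite /matching_adj eq_sym [_./2 == _]eq_sym. Qed.

Fact matching_irrefl m : irreflexive (@matching_adj m).
Proof. by move=> i; rewrite /matching_adj eqxx. Qed.

Definition matching m : sgraph := SGraph (@matching_sym m) (@matching_irrefl m).

Definition join_adj (G H : sgraph) : rel (G + H) := fun u v =>
  match u, v with
  | inl a, inl b => adj a b
  | inr a, inr b => adj a b
  | _, _ => true
  end.

Fact join_sym G H : symmetric (@join_adj G H).
Proof. by move=> [a|a] [b|b] //=; rewrite adj_sym. Qed.

Fact join_irrefl G H : irreflexive (@join_adj G H).
Proof. by move=> [a|a] /=; rewrite adj_irrefl. Qed.

Definition join G H : sgraph := SGraph (@join_sym G H) (@join_irrefl G H).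

(* [None] is the common vertex; the [i]-th quadrangle is
   None - (i,0) - (i,1) - (i,2) - None. *)
Definition quads_adj t : rel (option ('I_t * 'I_3)) := fun u v =>
  match u, v with
  | None, None => false
  | None, Some (_, k) | Some (_, k), None => k != 1%N :> nat
  | Some (i, k), Some (j, l) =>
      (i == j) && ((k.+1 == l :> nat) || (l.+1 == k :> nat))
  end.

Fact quads_sym t : symmetric (@quads_adj t).
Proof. by move=> [[i k]|] [[j l]|] //=; rewrite eq_sym orbC. Qed.

Fact quads_irrefl t : irreflexive (@quads_adj t).
Proof. by move=> [[i k]|] //=; rewrite eqxx orbb (gtn_eqF (ltnSn k)). Qed.

Definition quads t : sgraph := SGraph (@quads_sym t) (@quads_irrefl t).

End Constructions.

Section SignlessLaplacian.
Variables (R : realType) (G : sgraph).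

Definition degree (v : G) : nat := #|[pred u | adj v u]|.

Definition adj_mx : 'M[R]_#|G| :=
  \matrix_(i, j) (adj (enum_val i) (enum_val j))%:R.

Definition degree_mx : 'M[R]_#|G| :=
  diag_mx (\row_i (degree (enum_val i))%:R).

Definition signless_laplacian : 'M[R]_#|G| := degree_mx + adj_mx.

(* The supremum is a maximum, see [q_largest]; for the graph without vertices
   the set is empty and the value is 0. *)
Definition q : R := sup [set a : R | eigenvalue signless_laplacian a]%classic.

End SignlessLaplacian.

Section LargestEigenvalue.
Variables (R : realType).

Lemma sym_eigenvalue_exists n (A : 'M[R]_n) :
  (0 < n)%N -> A^T = A -> exists a, eigenvalue A a.
Proof.
move=> n0 symA.
pose f : {rmorphism R -> complex R} := real_complex R.
pose B := map_mx f A.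
have hB : B \is hermsymmx.
  apply: realsym_hermsym.
    by apply/is_hermitianmxP; rewrite expr0 scale1r map_mx_id// map_trmx symA.
  by apply/mxOverP => i j; rewrite mxE complex_real.
have /orthomx_spectralP[BE] : B \is normalmx by exact: hermitian_normalmx.
pose i := Ordinal n0; pose z := spectral_diag B 0 i.
have /complex_realP[a za] : z \is Num.real.
  by have /mxOverP := hermitian_spectral_diag_real hB; apply.
exists a; rewrite -(eigenvalue_map f); apply/eigenvalueP.
exists (row i (spectralmx B)).
  rewrite -/B {2}BE !mulmxA -row_mul mulmxV ?spectral_unit// row1.
  by rewrite -rowE row_diag_mx -/z za -scalemxAl -rowE.
have fP : row_free (spectralmx B) by rewrite row_free_unit spectral_unit.
rewrite rowE mulmx_free_eq0//; apply/eqP => /rowP/(_ i)/eqP.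
by rewrite !mxE !eqxx oner_eq0.
Qed.

Lemma largest_eigenvalue_exists n (A : 'M[R]_n) : (0 < n)%N -> A^T = A ->
  exists2 m, eigenvalue A m & forall a, eigenvalue A a -> a <= m.
Proof.
move=> n0 /(sym_eigenvalue_exists n0)[a0 ea0].
pose f : {rmorphism R -> complex R} := real_complex R.
have [rs rsE] := closed_field_poly_normal (char_poly (map_mx f A)).
pose s := [seq a <- map (@complex.Re R) rs | eigenvalue A a].
have sE a : eigenvalue A a -> a \in s.
  move=> ea; rewrite mem_filter ea /=; apply/mapP; exists (f a) => //.
  move: ea; rewrite -(eigenvalue_map f) eigenvalue_root_char rsE.
  rewrite (monicP (char_poly_monic _)) scale1r.
  by rewrite root_prod_XsubC.
have sub m : m \in s -> eigenvalue A m by rewrite mem_filter => /andP[].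
suff [m /sub em lem] : exists2 m, m \in s & forall a, a \in s -> a <= m.
  by exists m => // a /sE/lem.
have : s != [::] by apply: contraTneq (sE _ ea0) => ->.
elim: s {sE sub} => // a s IH _; case: (eqVneq s [::]) => [->|/IH[m ms lem]].
  by exists a => [|b]; rewrite inE // => /eqP->.
exists (Num.max a m) => [|b].
  by case: (leP a m) => _; rewrite inE ?ms ?eqxx ?orbT.
by rewrite inE le_max => /orP[/eqP->|/lem->]; rewrite ?lexx ?orbT.
Qed.

Lemma signless_laplacian_sym (G : sgraph) :
  (signless_laplacian R G)^T = signless_laplacian R G.
Proof.
rewrite /signless_laplacian linearD /= tr_diag_mx; congr (_ + _).
by apply/matrixP => i j; rewrite !mxE adj_sym.
Qed.

Lemma q_largest (G : sgraph) : (0 < #|G|)%N ->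
  eigenvalue (signless_laplacian R G) (q R G) /\
  forall a, eigenvalue (signless_laplacian R G) a -> a <= q R G.
Proof.
move=> G0.
have [m em lem] := largest_eigenvalue_exists G0 (signless_laplacian_sym G).
suff -> : q R G = m by [].
apply/eqP; rewrite eq_le /q; apply/andP; split.
  by apply: ge_sup; [exists m|move=> a /lem].
by apply: ub_le_sup => //; exists m => a /lem.
Qed.

End LargestEigenvalue.

(* Main.v *)
(* Only the subgraph Q_t is ever excluded, never a proper minor: the claim is
   that a graph G of large order n without Q_t as a subgraph and with
   q(G) >= q(K_t v M_{n-t}) is K_t v M_{n-t}.

   A vertex w having t others with at least 3t common neighbours each carries
   t quadrangles, by a greedy choice. So the number of walks of length 2 from a
   vertex v is at most t d(v) + 3tn; comparing an eigenvector with the vector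
   of degrees, this forces some degree d(w) >= n - 5t - 1. Then all vertices
   but w and the at most t - 1 ones sharing 3t neighbours with w have degree
   at most 8t. The eigenvector is O(1/n) off this core, and its equations on the
   core, with q(G) >= n + 2t - 2 - 1/(8t), force the core to consist of exactly
   t vertices of degree n - 1. Off the core G has no path on 3 vertices, so G is
   the join of K_t with a partial matching. Finally a positive vector
   which is an explicit eigenvector for K_t v M_{n-t} shows that the matching
   misses at most one vertex. *)

Require Import Defs.
From mathcomp Require Import all_boot all_order all_algebra.
From mathcomp Require Import reals.
From mathcomp Require classical_sets.
From mathcomp Require Import zify ring lra.

Set Implicit Arguments.
Unset Strict Implicit.
Unset Printing Implicit Defensive.

Import Order.TTheory GRing.Theory Num.Theory.
Local Open Scope ring_scope.

(** * Greedy construction of quadrangles through a common vertex *)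

Section Petals.
Local Open Scope nat_scope.
Variable G : sgraph.
Implicit Types (w x : G) (p : G * G * G) (s : seq (G * G * G)).

(** A triple [(a, x, b)] encodes the quadrangle w - a - x - b - w, so [p.1.2] is the vertex opposite
    to [w]. *)
Definition petal w p :=
  [&& adj w p.1.1, adj p.1.1 p.1.2, adj p.1.2 p.2 & adj p.2 w].

Definition petal_vertices s := flatten [seq [:: p.1.1; p.1.2; p.2] | p <- s].

Lemma size_petal_vertices s : size (petal_vertices s) = (3 * size s)%N.
Proof. by elim: s => //= p s ->; rewrite mulnS. Qed.

Lemma nth_petal_vertices w s i k : (i < size s)%N -> (k < 3)%N ->
  nth w (petal_vertices s) (3 * i + k) =
    nth w [:: (nth (w, w, w) s i).1.1; (nth (w, w, w) s i).1.2;
              (nth (w, w, w) s i).2] k.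
Proof.
elim: s i => //= p s IH [|i] lti ltk.
  by clear IH; case: k ltk => [|[|[|]]].
by rewrite mulnS -addnA /= IH.
Qed.

Lemma petals_subgraph w s : uniq (w :: petal_vertices s) ->
  all (petal w) s -> subgraph (quads (size s)) G.
Proof.
move=> us /allP ps.
(* The common vertex sits at index 0 of [w :: petal_vertices s], and vertex k of quadrangle i at
   index 3i + k + 1. *)
pose pos (v : quads (size s)) : nat :=
  if v is Some (i, k) then (3 * i + k).+1 else 0%N.
have pos_inj : injective pos.
  move=> [[i k]|] [[j l]|] //= e.
  have ik := ltn_ord k; have jl := ltn_ord l.
  have ij : i = j by apply: val_inj => /=; lia.
  have kl : k = l by apply: val_inj => /=; lia.
  by rewrite ij kl.
have pos_lt v : (pos v < size (w :: petal_vertices s))%N.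
  rewrite /= size_petal_vertices; case: v => [[i k]|] //=.
  have := ltn_ord i; have := ltn_ord k; lia.
exists (fun v => nth w (w :: petal_vertices s) (pos v)).
  by move=> u v /eqP; rewrite nth_uniq // => /eqP/pos_inj.
have petalP (i : 'I_(size s)) : petal w (nth (w, w, w) s i).
  by apply: ps; rewrite mem_nth.
move=> [[i k]|] [[j l]|] //=.
- case/andP=> /eqP <- kl; rewrite !nth_petal_vertices //.
  have /and4P[_ ax xb _] := petalP i.
  case: k kl => [[|[|[|k]]] //= lk]; case: l => [[|[|[|l]]] //= ll] //= _.
  + by rewrite adj_sym.
  + by rewrite adj_sym.
- rewrite nth_petal_vertices //; have /and4P[wa _ _ bw] := petalP i.
  by case: k => [[|[|[|k]]] //= lk] // _; rewrite adj_sym.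
- rewrite nth_petal_vertices //; have /and4P[wa _ _ bw] := petalP j.
  by case: l => [[|[|[|k]]] //= lk] // _; rewrite adj_sym.
Qed.

Definition common w x := [set u | adj w u && adj x u].

Lemma two_outside (A : {set G}) (r : seq G) : (size r + 2 <= #|A|)%N ->
  exists a b, [/\ a \in A, b \in A, a \notin r, b \notin r & a != b].
Proof.
move=> szA.
have : (1 < #|A :\: [set z in r]|)%N.
  have := cardsID [set z in r] A.
  have : (#|A :&: [set z in r]| <= size r)%N.
    apply: leq_trans (subset_leq_card (subsetIr _ _)) _.
    by rewrite cardsE card_size.
  by move=> *; lia.
case/card_gt1P => a [b []]; rewrite !inE => /andP[ar aA] /andP[br bA] ab.
by exists a, b.
Qed.

Lemma extend_petals w s xs :
  uniq (w :: petal_vertices s ++ xs) -> all (petal w) s ->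
  (forall x, x \in xs -> (3 * (size s + size xs) <= #|common w x|)%N) ->
  subgraph (quads (size s + size xs)) G.
Proof.
elim: xs s => [|x xs IH] s us ps cx.
  by rewrite addn0; apply: petals_subgraph ps; rewrite cats0 in us.
have [a [b [aA bA ar br ab]]] :
    exists a b, [/\ a \in common w x, b \in common w x,
      a \notin petal_vertices s ++ xs, b \notin petal_vertices s ++ xs & a != b].
  (* The [3 * size s] vertices in use and the entries of [xs] still waiting must be avoided; [w] and
     [x] are avoided automatically, being adjacent to the chosen vertices. *)
  apply: two_outside; rewrite size_cat size_petal_vertices.
  by apply: leq_trans (cx x _); rewrite ?mem_head //=; lia.
move: aA bA; rewrite !inE => /andP[wa xa] /andP[wb xb].
rewrite /= addnS -addSn; apply: (IH ((a, x, b) :: s)).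
- have neq (u v : G) : adj u v -> (u == v) = false.
    by move=> e; apply/negP => /eqP uv; rewrite uv adj_irrefl in e.
  move: us ar br; rewrite /= !(mem_cat, inE) cat_uniq /= !negb_or.
  case/and4P=> /and3P[w1 wx w2] us1 /andP[x1 x2] /andP[x3 uxs].
  case/andP=> a1 a2 /andP[b1 b2].
  rewrite (neq _ _ wa) (neq _ _ wb) wx w1 w2 [a == x]eq_sym (neq _ _ xa).
  rewrite (negbTE ab) a1 a2 (neq _ _ xb) x1 x3 b1 b2.
  by rewrite cat_uniq us1 x2 uxs.
- by rewrite /= /petal /= wa adj_sym xa xb adj_sym wb.
- by move=> y yx; rewrite /= addSn -addnS; apply: cx; rewrite inE yx orbT.
Qed.

Lemma card_rich w t : ~ subgraph (quads t) G ->
  (#|[set x | (x != w) && (3 * t <= #|common w x|)%N]| < t)%N.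
Proof.
move=> noQ; rewrite ltnNge; apply/negP => le; apply: noQ.
set A := [set x | _] in le.
have sz : size (take t (enum A)) = t by rewrite size_takel // -cardE.
have sub x : x \in take t (enum A) -> x \in A.
  by move/mem_take; rewrite mem_enum.
have := @extend_petals w [::] (take t (enum A)); rewrite /= sz; apply => //.
- rewrite take_uniq ?enum_uniq // andbT; apply/negP => /sub.
  by rewrite inE eqxx.
- by move=> x /sub; rewrite inE => /andP[].
Qed.

End Petals.

(** * The signless Laplacian as an operator on functions *)

Section SignlessOperator.
Variables (R : realType) (G : sgraph).
Implicit Types (f x y : G -> R) (v : G).

Definition sl_op f v := (degree v)%:R * f v + \sum_(u | adj v u) f u.

Lemma mul_signless_laplacian (z : 'rV[R]_#|G|) j :
  (z *m signless_laplacian R G) 0 j =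
    sl_op (fun v => z 0 (enum_rank v)) (enum_val j).
Proof.
rewrite mulmxDr mxE mul_mx_diag !mxE /sl_op enum_valK [_ * z _ _]mulrC.
congr (_ + _); rewrite [RHS]big_mkcond /= [RHS](reindex _ (onW_bij _ (@enum_val_bij G))) /=.
apply: eq_bigr => i _; rewrite mxE enum_valK adj_sym.
by case: adj; rewrite ?mulr1 ?mulr0.
Qed.

Lemma eigenvalue_sl_op a : eigenvalue (signless_laplacian R G) a <->
  exists2 f, (exists v, f v != 0) & forall v, sl_op f v = a * f v.
Proof.
split=> [/eigenvalueP[z zE /rV0Pn[i zi]]|[f [v fv] fE]].
  exists (fun v => z 0 (enum_rank v)); first by exists (enum_val i); rewrite enum_valK.
  move=> v; have := mul_signless_laplacian z (enum_rank v).
  by rewrite zE mxE enum_rankK => <-.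
apply/eigenvalueP; exists (\row_i f (enum_val i)).
  apply/rowP => i; rewrite mul_signless_laplacian !mxE -fE /sl_op.
  congr (_ + _); last by apply: eq_bigr => u _; rewrite mxE enum_rankK.
  by rewrite mxE enum_rankK.
by apply/rV0Pn; exists (enum_rank v); rewrite mxE enum_rankK.
Qed.

(** By the triangle inequality, the absolute value of an eigenvector for [q R G] has this property.
    It takes the place of a Perron vector. *)
Lemma q_subeigenvector : (0 < #|G|)%N -> exists y,
  [/\ forall v, 0 <= y v, exists v, 0 < y v &
      forall v, q R G * y v <= sl_op y v].
Proof.
case/(q_largest R) => /eigenvalue_sl_op[f [v0 fv0] fE] _.
exists (fun v => `|f v|); split=> [v||v]; first exact: normr_ge0.
  by exists v0; rewrite normr_gt0.
apply: (@le_trans _ _ `|q R G * f v|).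
  by rewrite normrM ler_wpM2r ?ler_norm.
rewrite -fE (le_trans (ler_normD _ _)) // lerD ?ler_norm_sum //.
by rewrite normrM ger0_norm.
Qed.

Lemma sl_op_sym x y : \sum_v x v * sl_op y v = \sum_v sl_op x v * y v.
Proof.
under eq_bigr do rewrite mulrDr; under [RHS]eq_bigr do rewrite mulrDl.
rewrite !big_split; congr (_ + _); first by apply: eq_bigr => v _; ring.
under eq_bigr do rewrite big_distrr big_mkcond /=.
rewrite exchange_big; apply: eq_bigr => v _.
rewrite big_distrl [RHS]big_mkcond; apply: eq_bigr => u _.
by rewrite adj_sym.
Qed.

End SignlessOperator.

(** * Invariance of q under isomorphism *)

Section Isomorphism.
Variable R : realType.
Implicit Types G H : sgraph.

Lemma giso_sym G H : giso G H -> giso H G.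
Proof.
case=> f [g fK gK] fE; exists g; first by exists f.
by move=> u v; rewrite -{2}(gK u) -{2}(gK v) fE.
Qed.

Lemma eigenvalue_giso G H a : giso G H ->
  eigenvalue (signless_laplacian R H) a -> eigenvalue (signless_laplacian R G) a.
Proof.
case=> f bf fE /eigenvalue_sl_op[h [v hv] hE]; apply/eigenvalue_sl_op.
have [g fK gK] := bf; exists (h \o f); first by exists (g v); rewrite /= gK.
move=> u /=; rewrite -hE /sl_op; congr (_ * _ + _).
  congr (_%:R); rewrite /degree -(card_image (bij_inj bf)).
  apply: eq_card => x; rewrite [RHS]inE; apply/imageP/idP => [[y]|ux].
    by rewrite inE => uy ->; rewrite fE.
  by exists (g x); rewrite ?gK // inE -fE gK.
rewrite [RHS](reindex f) /=; last exact: onW_bij.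
by apply: eq_bigl => x; rewrite fE.
Qed.

Lemma q_giso G H : giso G H -> q R G = q R H.
Proof.
move=> GH; congr sup; apply/classical_sets.seteqP; split=> a; apply: eigenvalue_giso => //.
exact: giso_sym.
Qed.

End Isomorphism.

(** * Common neighbours, degrees and the core of a vertex *)

Section Core.
Local Open Scope nat_scope.
Variables (G : sgraph) (t : nat).
Implicit Types v w x : G.

(** For [w] of nearly full degree this set will turn out to be the clique K_t of the extremal
    graph. *)
Definition core w := [set x | (x == w) || (3 * t <= #|common w x|)%N].

Lemma card_core w : ~ subgraph (quads t) G -> (#|core w| <= t)%N.
Proof.
move/(card_rich w); apply: leq_trans.
rewrite (cardsD1 w) inE eqxx /= add1n ltnS; apply: subset_leq_card.
by apply/subsetP => x; rewrite !inE => /andP[/negPf -> /= ->].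
Qed.

Lemma degree_lt v : (degree v < #|G|)%N.
Proof.
apply/proper_card/properP; split; first exact/subsetP.
by exists v; rewrite // inE adj_irrefl.
Qed.

Lemma card_common_le w x : (#|common w x| <= degree w)%N.
Proof.
by apply: subset_leq_card; apply/subsetP => u; rewrite !inE => /andP[].
Qed.

(** Both sides count walks of length 2 from [v], by middle vertex and by end vertex. *)
Lemma sum_degree_common v :
  (\sum_(u | adj v u) degree u = \sum_x #|common v x|)%N.
Proof.
under eq_bigr do rewrite /degree -sum1_card big_mkcond /=.
rewrite exchange_big; apply: eq_bigr => x _.
rewrite -sum1_card -big_mkcondr; apply: eq_bigl => u.
by rewrite !inE adj_sym [adj u x]adj_sym [adj u v]adj_sym.
Qed.

(** At most t ends lie in the core of [v], each reached by at most [degree v] walks; any other end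
    is reached by fewer than 3t. *)
Lemma sum_degree_le v : ~ subgraph (quads t) G ->
  (\sum_(u | adj v u) degree u <= t * degree v + 3 * t * #|G|)%N.
Proof.
move=> noQ; rewrite sum_degree_common.
apply: (@leq_trans (\sum_x ((if x \in core v then degree v else 0) + 3 * t))%N).
  apply: leq_sum => x _; rewrite inE; case: ifP => [_|/norP[_]].
    by rewrite (leq_trans (card_common_le _ _)) ?leq_addr.
  by rewrite -ltnNge => /ltnW.
rewrite big_split /= sum_nat_const [X in (_ + X)%N]mulnC leq_add2r.
by rewrite -big_mkcond sum_nat_const leq_mul2r card_core ?orbT.
Qed.

(** Of the neighbours of [x], at most 3t - 1 are adjacent to [w] and at most 5t + 1 are not. *)
Lemma degree_off_core w x : (#|G| <= degree w + 5 * t + 1)%N ->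
  x \notin core w -> (degree x <= 8 * t)%N.
Proof.
move=> hw; rewrite inE negb_or -ltnNge => /andP[_ rx].
have : (degree x <= #|common w x| + #|[predC [pred u | adj w u]]|)%N.
  rewrite /degree -(cardID [pred u | adj w u] [pred u | adj x u]) leq_add //.
    apply: subset_leq_card; apply/subsetP => u.
    by rewrite !inE andbC.
  by apply: subset_leq_card; apply/subsetP => u; rewrite !inE => /andP[].
have : (degree w + #|[predC [pred u | adj w u]]| = #|G|)%N.
  by rewrite -(cardC [pred u | adj w u]).
lia.
Qed.

End Core.


(** * Existence of a vertex of nearly full degree *)

Section LargeDegrees.
Variables (R : realType) (G : sgraph) (t : nat) (r : R) (y : G -> R).
Hypothesis t_gt0 : (0 < t)%N.
Hypothesis y_neq0 : exists v, 0 < y v.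
Hypothesis y_sub : forall v, r * y v <= sl_op y v.

(* Comparing [y] with the vector of degrees. *)
Lemma exists_degree_sum : 0 < r -> exists2 v : G, (0 < degree v)%N &
  (r - (degree v)%:R) * (degree v)%:R <= (\sum_(u | adj v u) degree u)%:R.
Proof.
move=> r0; have [v0 yv0] := y_neq0.
have dv0 : (0 < degree v0)%N.
  rewrite lt0n; apply/eqP => d0; have := y_sub v0.
  rewrite /sl_op d0 mul0r add0r big_pred0 => [|u]; last first.
    by have := card0_eq d0 u; rewrite inE.
  by rewrite leNgt mulr_gt0.
(* Where this ratio is largest, [y u <= degree u * F v] for all neighbours [u], so the inequality
   [y_sub] at [v] becomes a bound on the sum of their degrees. *)
pose F v := y v / (degree v)%:R.
case: (@arg_maxP _ _ _ v0 (fun v : G => 0 < degree v)%N F dv0) => v dv maxv.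
have dR : 0 < (degree v)%:R :> R by rewrite ltr0n.
have yv : 0 < y v.
  have : 0 < F v by apply: lt_le_trans (maxv _ dv0); rewrite divr_gt0 ?ltr0n.
  by rewrite /F pmulr_lgt0 // invr_gt0.
exists v => //.
have le_sum : \sum_(u | adj v u) y u <= \sum_(u | adj v u) (degree u)%:R * F v.
  apply: ler_sum => u vu; have du : (0 < degree u)%N.
    by rewrite lt0n; apply/eqP => d0; have := card0_eq d0 v; rewrite inE adj_sym vu.
  by rewrite mulrC -ler_pdivrMr ?ltr0n //; apply: maxv.
rewrite -(ler_pM2r yv) natr_sum.
have := y_sub v; rewrite /sl_op -mulr_suml in le_sum *.
set s := \sum_(u | _) y u in le_sum *; set e := \sum_(u | _) _ in le_sum *.
have -> : e = e * F v * (degree v)%:R / y v.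
  by rewrite /F; field; rewrite !gt_eqF.
rewrite divfK ?gt_eqF // => h.
rewrite mulrAC ler_pM2r // (le_trans _ le_sum) // mulrBl; lra.
Qed.

(** The vertex [v] of the degree comparison is itself a witness if its degree is at least 4t, by the
    bound on walks of length 2. Otherwise the degree sum over its few neighbours is too large unless
    some vertex has large degree. *)
Lemma exists_large_degree : (30 * t < #|G|)%N -> ~ subgraph (quads t) G ->
  #|G|%:R - 1 <= r -> exists w : G, (#|G| <= degree w + 5 * t + 1)%N.
Proof.
move=> n_big noQ r_ge.
have [|v dv hv] := exists_degree_sum.
  by apply: lt_le_trans r_ge; rewrite subr_gt0 ltr1n; lia.
have {r_ge}hv : (#|G| * degree v <=
    \sum_(u | adj v u) degree u + (degree v).+1 * degree v)%N.
  rewrite -(ler_nat R) natrD !natrM -natr1; apply: le_trans (lerD hv (lexx _)).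
  by rewrite -mulrDl ler_wpM2r ?ler0n //; lra.
case: (leqP (4 * t) (degree v)) => [dv_ge|dv_lt].
  exists v; rewrite leqNgt; apply/negP => lt; have := sum_degree_le v noQ.
  move: hv; set S := (\sum_(_ | _) _)%N; move: (degree v) lt dv_ge => d.
  set n := #|_| in n_big * => lt dv_ge h1 h2.
  have [a da] : exists a, d = (4 * t + a)%N by exists (d - 4 * t)%N; lia.
  have [b nb] : exists b, n = (d + 5 * t + 2 + b)%N.
    by exists (n - (d + 5 * t + 2))%N; lia.
  (* Here n = 9t + a + b + 2 exceeds 30t. The resulting bound on t(a + b) outweighs the terms in t
     alone when [h1] and [h2] are combined. *)
  have : (t * (21 * t) <= t * (a + b + 1))%N by rewrite leq_mul2l; lia.
  by subst n d; nia.
(* If all degrees were at most n - 5t - 2, then nd <= d(n - 5t - 2) + (d + 1)d, so d >= 5t + 1,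
   against d < 4t. *)
apply/existsP; rewrite -[[exists _, _]]negbK; apply/negP => /existsPn lt.
have : (\sum_(u | adj v u) degree u <= \sum_(u | adj v u) (#|G| - (5 * t + 2)))%N.
  by apply: leq_sum => u _; have := lt u; lia.
rewrite sum_nat_const -/(degree v).
move: hv; set S := (\sum_(_ | _) _)%N; move: (degree v) dv dv_lt => d.
set n := #|_| in n_big * => d0 d4 h1 h2.
have : (n * d <= d * (n - (5 * t + 2)) + d.+1 * d)%N by lia.
rewrite [(d * _)%N]mulnC -mulnDl leq_pmul2r //; lia.
Qed.

End LargeDegrees.

(** * Eigenvector estimates on and off the core *)

Section DominatingCore.
Variables (R : realType) (G : sgraph) (t : nat) (r : R) (y : G -> R).
Variable S : {set G}.
Hypothesis t_gt0 : (0 < t)%N.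
Hypothesis y_ge0 : forall v, 0 <= y v.
Hypothesis y_neq0 : exists v, 0 < y v.
Hypothesis y_sub : forall v, r * y v <= sl_op y v.
Hypothesis card_S : (#|S| <= t)%N.
Hypothesis degree_S : forall v, v \notin S -> (degree v <= 8 * t)%N.

(** At a vertex x outside [S] where [y] is largest, the degree term and the neighbours outside [S]
    each contribute at most 8t times [y x], and the neighbours in [S] at most tM in total. *)
Lemma light_entry M v : (forall u, u \in S -> y u <= M) -> 0 <= M ->
  16 * t%:R <= r -> v \notin S -> (r - 16 * t%:R) * y v <= t%:R * M.
Proof.
move=> yM M0 r_ge vS.
case: (@arg_maxP _ _ _ v (fun v => v \notin S) y vS) => x xS maxx.
apply: (@le_trans _ _ ((r - 16 * t%:R) * y x)).
  by rewrite ler_wpM2l ?subr_ge0 //; apply: maxx.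
have dx : (degree x)%:R <= 8 * t%:R :> R by rewrite -natrM ler_nat degree_S.
have : \sum_(u | adj x u) y u <= (degree x)%:R * y x + t%:R * M.
  apply: (@le_trans _ _ (\sum_(u | adj x u) (y x + if u \in S then M else 0))).
    apply: ler_sum => u _; case: ifP => uS; first by rewrite ler_wpDl // yM.
    by rewrite addr0; apply: maxx; rewrite /= uS.
  rewrite big_split /= sumr_const -/(degree x) mulr_natl lerD2l.
  rewrite -big_mkcondr /= sumr_const -[M *+ _]mulr_natl ler_wpM2r // ler_nat.
  apply: leq_trans card_S; apply: subset_leq_card.
  by apply/subsetP => u /andP[].
have := y_sub x; rewrite /sl_op.
have := ler_wpM2r (y_ge0 x) dx.
move: (\sum_(_ | _) _) ((degree x)%:R * y x) => s e; lra.
Qed.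

Hypothesis S_neq0 : (0 < #|S|)%N.
Hypothesis n_big : (1000 * t ^ 3 <= #|G|)%N.
Hypothesis r_ge : #|G|%:R + 2 * t%:R - 2 - (8 * t%:R)^-1 <= r.

(** With M the maximum of [y] on [S], the entries outside [S] are so small that their total is at
    most (t + 1/(8t))M. The neighbours of [u] in [S] contribute at most the sum over [S] minus
    [y u], whence the +1 on the left. *)
Lemma core_row : exists M, [/\ 0 < M, forall u, u \in S -> y u <= M,
    exists2 w, w \in S & y w = M & forall u, u \in S ->
  (r - (degree u)%:R + 1) * y u <=
    \sum_(z in S) y z + (t%:R + (8 * t%:R)^-1) * M].
Proof.
have t1 : 1 <= t%:R :> R by rewrite ler1n.
have := r_ge; set d := (8 * t%:R)^-1 => r_ged.
have dt : 8 * t%:R * d = 1 by rewrite mulfV // gt_eqF //; lra.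
have d0 : 0 < d by rewrite invr_gt0; lra.
have nR : 1000 * t%:R ^+ 3 <= #|G|%:R :> R by rewrite -natrX -natrM ler_nat.
have t3 : t%:R <= t%:R ^+ 2 :> R /\ t%:R ^+ 2 <= t%:R ^+ 3 :> R.
  by rewrite !expr2 exprS expr2; split; nra.
have d1 : d <= 1 by nra.
have r16 : 16 * t%:R < r by lra.
have [w0 w0S] := card_gt0P S_neq0.
case: (@arg_maxP _ _ _ w0 (mem S) y w0S) => w wS maxw.
have light v : v \notin S -> (r - 16 * t%:R) * y v <= t%:R * y w.
  by apply: light_entry => //; apply: ltW.
have yw : 0 < y w.
  (* If the maximum on [S] were 0, the bound [light] would make [y] vanish everywhere. *)
  rewrite lt_neqAle y_ge0 andbT; apply/eqP => yw0.
  have [v yv] := y_neq0; have := yv; rewrite ltNge => /negP; apply.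
  case: (boolP (v \in S)) => vS; first by rewrite yw0; apply: maxw.
  have := light v vS; rewrite -yw0 mulr0 pmulr_rle0 //; lra.
exists (y w); split=> // [|u uS]; first by exists w.
have sum_le : \sum_(z | adj u z) y z <=
    \sum_(z in S) y z - y u + \sum_(z | z \notin S) y z.
  have -> : \sum_(z in S) y z = y u + \sum_(z in S | z != u) y z.
    by rewrite (bigD1 u).
  rewrite [y u + _]addrC addrK.
  rewrite (bigID (mem S)) /= lerD //.
    rewrite big_mkcond [leRHS]big_mkcond ler_sum // => z _.
    case: (eqVneq z u) => [->|zu]; first by rewrite adj_irrefl /= andbF.
    by rewrite andbT; case: (z \in S); case: adj => //=.
  rewrite big_mkcond [leRHS]big_mkcond ler_sum // => z _.
  by case: (z \in S); case: adj => //=.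
have tail : \sum_(z | z \notin S) y z <= (t%:R + d) * y w.
  rewrite -(ler_pM2l (_ : 0 < r - 16 * t%:R)) ?subr_gt0 //.
  rewrite big_distrr /= (le_trans (ler_sum _ (fun z zS => light z zS))) //.
  rewrite sumr_const -[_ * _ *+ _]mulr_natl mulrA mulrA ler_wpM2r //.
  apply: (@le_trans _ _ (#|G|%:R * t%:R)).
    by rewrite ler_wpM2r ?ler0n // ler_nat max_card.
  (* The goal nt <= (r - 16t)(t + d) follows from nd >= 125t^2, since the loss (1 + 16t)(t + d) is
     at most 34t^2. *)
  have nd : 1000 * t%:R ^+ 3 * d <= #|G|%:R * d by rewrite ler_wpM2r // ltW.
  have e3 : 1000 * t%:R ^+ 3 * d = 125 * t%:R ^+ 2.
    by transitivity (125 * t%:R ^+ 2 * (8 * t%:R * d)); [ring|rewrite dt mulr1].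
  have rlow : #|G|%:R - 1 - 16 * t%:R <= r - 16 * t%:R by lra.
  apply: le_trans (ler_wpM2r _ rlow); [|by lra].
  have : (1 + 16 * t%:R) * (t%:R + d) <= (17 * t%:R) * (2 * t%:R).
    by apply: ler_pM; lra.
  have -> : (17 * t%:R) * (2 * t%:R) = 34 * t%:R ^+ 2 :> R by ring.
  have := sqr_ge0 (t%:R : R).
  by rewrite e3 in nd; lra.
have := y_sub u; rewrite /sl_op => h.
have {sum_le tail} := le_trans sum_le (lerD (lexx _) tail).
move: h; move: (\sum_(z | adj u z) _) (\sum_(z in S) _) => A B.
rewrite !mulrDl mulNr mul1r.
move: (_ * y u) (_ * y u) (_ * y w) (_ * y w) => *; lra.
Qed.

(** With d = 1/(8t), the row at the maximum M gives a sum over [S] of at least (t - 2d)M. Fewer than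
    t entries cannot reach it, and with t entries each is at least (1 - 2d)M. A degree at most n - 2
    would then break the row at that vertex. *)
Lemma core_dominating : #|S| = t /\ forall u, u \in S -> degree u = #|G|.-1.
Proof.
have [M [M0 yM [w wS yw] row]] := core_row.
have t1 : 1 <= t%:R :> R by rewrite ler1n.
move: r_ge row; set d := (8 * t%:R)^-1 => r_ged row.
have dt : 8 * t%:R * d = 1 by rewrite mulfV // gt_eqF //; lra.
have d0 : 0 < d by rewrite invr_gt0; lra.
have d1 : 8 * d <= 1 by nra.
have degR (u : G) : (degree u)%:R <= #|G|%:R - 1 :> R.
  by rewrite lerBrDr natr1 ler_nat degree_lt.
have T_le u : u \in S -> \sum_(z in S) y z <= y u + (#|S|%:R - 1) * M.
  move=> uS; rewrite (bigD1 u) //= lerD2l.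
  apply: (@le_trans _ _ (\sum_(z in S | z != u) M)).
    by apply: ler_sum => z /andP[/yM].
  rewrite sumr_const -[M *+ _]mulr_natl ler_wpM2r ?(ltW M0) //.
  rewrite lerBrDr natr1 ler_nat [leqRHS](cardD1 u) uS add1n ltnS.
  by apply: subset_leq_card; apply/subsetP => z; rewrite !inE andbC.
have cS : #|S|%:R <= t%:R :> R by rewrite ler_nat.
have := row w wS; set T := \sum_(z in S) y z in row T_le *; rewrite yw => roww.
have Tge : (t%:R - 2 * d) * M <= T.
  have : (2 * t%:R - d) * M <= (r - (degree w)%:R + 1) * M.
    by rewrite ler_pM2r //; have := degR w; lra.
  move: roww; rewrite !mulrBl !mulrDl; lra.
have card_eq : #|S| = t.
  apply/eqP; rewrite eqn_leq card_S /= -(ler_nat R) leNgt; apply/negP => lt.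
  have : #|S|%:R <= t%:R - 1 :> R.
    by rewrite lerBrDr natr1 ler_nat -(ltr_nat R).
  move=> lt'; have := T_le w wS; rewrite yw => h.
  have : (t%:R - 2 * d) * M <= (t%:R - 1) * M.
    apply: le_trans Tge _; apply: le_trans h _.
    by rewrite -{1}[M]mul1r -mulrDl ler_pM2r //; lra.
  by rewrite ler_pM2r //; lra.
split=> // u uS; apply/eqP; rewrite eqn_leq; apply/andP; split.
  by have := degree_lt u; case: #|G|.
rewrite leqNgt; apply/negP => lt.
have {}lt : (degree u)%:R <= #|G|%:R - 2 :> R.
  by rewrite lerBrDr -natrD ler_nat; have := degree_lt u; lia.
have yu : (1 - 2 * d) * M <= y u.
  have := T_le u uS; rewrite card_eq => h.
  by have := le_trans Tge h; rewrite !mulrBl; lra.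
have TM : T <= t%:R * M.
  by have := T_le w wS; rewrite yw card_eq mulrBl; lra.
have := row u uS => h.
(* After division by M this reads 1 - 4d - 4td + 2d^2 <= 0, which is false because 4td = 1/2 and 4d
   <= 1/2. *)
have : (2 * t%:R + 1 - d) * ((1 - 2 * d) * M) <= (t%:R + (t%:R + d)) * M.
  apply: le_trans (_ : _ <= T + (t%:R + d) * M) _; last first.
    by rewrite [leRHS]mulrDl lerD2r.
  apply: le_trans h.
  by apply: ler_pM => //; try lra; apply: mulr_ge0; lra.
rewrite mulrA ler_pM2r // => h'; nra.
Qed.

End DominatingCore.

(** * Joins of a clique with a partial matching *)

Section Cone.
Variable G : sgraph.
Implicit Types (L : {set G}) (u v : G).

Definition cone L :=
  (forall v u, v \in L -> u != v -> adj v u) /\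
  (forall v u u', v \notin L -> u \notin L -> u' \notin L ->
    adj v u -> adj v u' -> u = u').

Definition unmatched L :=
  [set v | (v \notin L) && [forall u, adj v u ==> (u \in L)]].

Variables (R : realType) (L : {set G}) (theta : R).
Hypothesis coneL : cone L.
Hypothesis theta_gt : #|L|%:R + 2 < theta.

(* This is an eigenvector for [theta] as soon as [theta] is the value
   [cone_row #|unmatched L|] taken by the operator at the vertices of [L]. *)
Definition cone_vector v : R :=
  if v \in L then 1 else
  if v \in unmatched L then #|L|%:R / (theta - #|L|%:R)
  else #|L|%:R / (theta - #|L|%:R - 2).

(** The degree n - 1 and the other vertices of [L] account for n + |L| - 2. The number b of
    unmatched vertices is left free so that different matchings can be compared. *)
Definition cone_row (b : nat) : R :=
  #|G|%:R + #|L|%:R - 2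
  + (#|G| - #|L| - b)%:R * (#|L|%:R / (theta - #|L|%:R - 2))
  + b%:R * (#|L|%:R / (theta - #|L|%:R)).

(** With l = |L|, the entries solve lp + l = theta p at an unmatched vertex and (l + 1)p + l + p =
    theta p at a matched one. *)
Lemma cone_vector_out v : v \notin L ->
  sl_op cone_vector v = theta * cone_vector v.
Proof.
move=> vL; have [uL outL] := coneL.
have vx u : u \in L -> adj v u.
  move=> uLu; rewrite adj_sym; apply: uL => //.
  by apply: contraNneq vL => ->.
have sumL (F : G -> R) : \sum_(u | adj v u) F u =
    \sum_(u in L) F u + \sum_(u | adj v u && (u \notin L)) F u.
  rewrite (bigID (mem L)) /=; congr (_ + _); apply: eq_bigl => u.
  by case: (boolP (u \in L)) => [/vx ->|]; rewrite ?andbF.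
rewrite /sl_op /degree -sum1_card natr_sum !sumL.
have onL (F : G -> R) : (forall u, u \in L -> F u = 1) ->
    \sum_(u in L) F u = #|L|%:R.
  by move=> F1; rewrite (eq_bigr (fun=> 1)) // sumr_const.
rewrite !onL //; last by move=> u; rewrite /cone_vector => ->.
have tn : theta - #|L|%:R - 2 != 0 by rewrite gt_eqF //; move: theta_gt; lra.
have tn' : theta - #|L|%:R != 0 by rewrite gt_eqF //; move: theta_gt; lra.
case: (boolP (v \in unmatched L)) => vU.
  have none u : adj v u && (u \notin L) = false.
    move: vU; rewrite inE vL /= => /forallP/(_ u)/implyP h.
    by apply/negP => /andP[/h ->].
  rewrite !big_pred0 ?none // /cone_vector (negPf vL) vU !addr0.
  by field.
have [w vw wL] : exists2 w, adj v w & w \notin L.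
  move: vU; rewrite inE vL /= => /forallPn[w]; rewrite negb_imply => /andP[vw wL].
  by exists w.
have only u : adj v u && (u \notin L) = (u == w).
  apply/andP/eqP => [[vu uL']|->//]; exact: (outL v).
rewrite (eq_bigl _ _ only) [X in _ + (_ + X)](eq_bigl _ _ only) !big_pred1_eq.
have wU : w \notin unmatched L.
  rewrite inE wL /=; apply/forallPn; exists v.
  by rewrite adj_sym vw.
rewrite /cone_vector (negPf vL) (negPf wL) (negPf vU) (negPf wU).
by field.
Qed.

Lemma cone_vector_in v : v \in L ->
  sl_op cone_vector v = cone_row #|unmatched L|.
Proof.
move=> vL; have [uL _] := coneL.
have adjE u : adj v u = (u != v).
  by apply/idP/idP => [|/uL]; [apply: contraTneq => ->; rewrite adj_irrefl|apply].
have deg : (degree v)%:R = #|G|%:R - 1 :> R.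
  have -> : #|G| = (degree v).+1.
    rewrite (cardD1 v) add1n; congr (_.+1); apply: eq_card => u.
    by rewrite !inE adjE andbT.
  by rewrite -natr1 addrK.
rewrite /sl_op deg.
have : \sum_u cone_vector u = 1 + \sum_(u | adj v u) cone_vector u.
  rewrite (bigD1 v) //= {1}/cone_vector vL; congr (_ + _).
  by apply: eq_bigl => u; rewrite adjE.
have UL : unmatched L \subset ~: L.
  by apply/subsetP => u; rewrite !inE => /andP[].
have cU : #|~: L :\: unmatched L| = (#|G| - #|L| - #|unmatched L|)%N.
  by rewrite cardsD (setIidPr UL) -[in RHS](cardsC L) addKn.
have -> : \sum_u cone_vector u = #|L|%:R +
    (#|G| - #|L| - #|unmatched L|)%:R * (#|L|%:R / (theta - #|L|%:R - 2))
    + #|unmatched L|%:R * (#|L|%:R / (theta - #|L|%:R)).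
  rewrite (bigID (mem L)) -addrA /=; congr (_ + _).
    rewrite (eq_bigr (fun=> 1)) ?sumr_const // => u.
    by rewrite /cone_vector => ->.
  rewrite (bigID (mem (unmatched L))) /= addrC; congr (_ + _).
    rewrite -cU mulr_natl -sumr_const; apply: eq_big => [u|u /andP[uL' uU]].
      by rewrite !inE andbC.
    by rewrite /cone_vector (negPf uL') (negPf uU).
  rewrite mulr_natl -sumr_const; apply: eq_big => [u|u /andP[uL' uU]].
    by rewrite !inE; case: (u \in L).
  by rewrite /cone_vector (negPf uL') uU.
rewrite /cone_vector vL /cone_row mulr1 => h.
by move: h; set s := \sum_(_ | _) _ => h; lra.
Qed.

(** Unmatched vertices carry the smaller of the two entries. *)
Lemma cone_row_decreasing b c : (0 < #|L|)%N -> (b < c <= #|G| - #|L|)%N ->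
  cone_row c < cone_row b.
Proof.
move=> L0 /andP[bc cn]; have L1 : 0 < #|L|%:R :> R by rewrite ltr0n.
have Ln : (#|L| <= #|G|)%N := max_card _.
rewrite /cone_row !natrB ?(leq_trans (ltnW bc) cn) //.
have lt : #|L|%:R / (theta - #|L|%:R) < #|L|%:R / (theta - #|L|%:R - 2).
  by rewrite ltr_pM2l // ltf_pV2 ?posrE; move: theta_gt; lra.
have bcR : b%:R < c%:R :> R by rewrite ltr_nat.
set p := #|L|%:R / (theta - #|L|%:R) in lt *.
set p' := #|L|%:R / (theta - #|L|%:R - 2) in lt *.
have : 0 < (c%:R - b%:R) * (p' - p) by rewrite mulr_gt0 ?subr_gt0.
by lra.
Qed.

Lemma cone_q_ge : (0 < #|L|)%N -> theta = cone_row #|unmatched L| ->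
  theta <= q R G.
Proof.
move=> L0 thE; have [v vL] := card_gt0P L0.
have G0 : (0 < #|G|)%N by apply/card_gt0P; exists v.
apply: (q_largest R G0).2; apply/eigenvalue_sl_op; exists cone_vector.
  by exists v; rewrite /cone_vector vL oner_eq0.
move=> u; case: (boolP (u \in L)) => uL; last exact: cone_vector_out.
by rewrite cone_vector_in // /cone_vector uL mulr1 -thE.
Qed.

(** With more than b unmatched vertices, the operator maps [cone_vector] x below theta x, strictly
    on [L]. Pairing with [y] and using self-adjointness gives a value less than theta times the sum
    of x y, while [y_sub] makes it at least r times that sum. *)
Lemma cone_subeigenvector r (y : G -> R) b : (0 < #|L|)%N ->
  (forall v, 0 <= y v) -> (exists2 w, w \in L & 0 < y w) ->
  (forall v, r * y v <= sl_op y v) -> theta <= r -> theta = cone_row b ->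
  (#|unmatched L| <= b)%N.
Proof.
move=> L0 y0 [w wL yw] y_sub th_le thE; rewrite leqNgt; apply/negP => lt.
have : cone_row #|unmatched L| < theta.
  rewrite thE; apply: cone_row_decreasing => //; rewrite lt /=.
  rewrite -(cardsC L) addKn; apply: subset_leq_card.
  by apply/subsetP => u; rewrite !inE => /andP[].
have x0 v : 0 <= cone_vector v.
  rewrite /cone_vector; case: ifP => // _.
  by case: ifP => _; rewrite divr_ge0 ?ler0n //; move: theta_gt; lra.
move=> row_lt.
have : \sum_v cone_vector v * sl_op y v < \sum_v theta * cone_vector v * y v.
  rewrite sl_op_sym (bigD1 w) //= [ltRHS](bigD1 w) //=; apply: ltr_leD.
    by rewrite cone_vector_in // /cone_vector wL mulr1 ltr_pM2r.
  apply: ler_sum => v _; case: (boolP (v \in L)) => vL; last first.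
    by rewrite cone_vector_out.
  by rewrite cone_vector_in // /cone_vector vL mulr1 ler_wpM2r // ltW.
rewrite ltNge => /negP; apply; apply: ler_sum => v _.
rewrite mulrAC mulrC ler_wpM2l // (le_trans _ (y_sub v)) // ler_wpM2r //.
Qed.

End Cone.

(** * Solving the eigenvalue equation of the extremal graph *)

Lemma cone_row_root (R : realType) (t n b : nat) :
  (0 < t)%N -> (1000 * t ^ 3 <= n)%N -> (b <= n - t)%N ->
  exists theta : R, [/\ n%:R + 2 * t%:R - 2 - (8 * t%:R)^-1 <= theta,
    t%:R + 2 < theta &
    theta = n%:R + t%:R - 2 + (n - t - b)%:R * (t%:R / (theta - t%:R - 2))
            + b%:R * (t%:R / (theta - t%:R))].
Proof.
move=> t0 n_big b_le.
have t1 : 1 <= t%:R :> R by rewrite ler1n.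
set d := (8 * t%:R)^-1.
have dt : 8 * t%:R * d = 1 by rewrite mulfV // gt_eqF //; lra.
have d0 : 0 < d by rewrite invr_gt0; lra.
have d1 : 8 * d <= 1 by nra.
have tn : (t <= n)%N by apply: leq_trans n_big; rewrite -{1}[t]muln1; nia.
have nR : 1000 * t%:R ^+ 3 <= n%:R :> R by rewrite -natrX -natrM ler_nat.
have t2 : t%:R <= t%:R ^+ 2 :> R by nra.
have t3 : t%:R ^+ 2 <= t%:R ^+ 3 :> R by rewrite exprS; nra.
have bR : b%:R <= n%:R - t%:R :> R by rewrite -natrB // ler_nat.
rewrite !natrB //; clearbody d; move: (n%:R : R) (t%:R : R) (b%:R : R) (ler0n R b)
  nR t1 t2 t3 bR dt => {n_big b_le t0 tn}N T B B0 NT T1 T2 T3 BN dT.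
(* This cubic is the equation for theta with denominators cleared. A sign change between N + 2T - 2
   - d and N + 2T yields a root with the required lower bound. *)
pose p : {poly R} := ('X - (N + T - 2)%:P) * ('X - (T + 2)%:P) * ('X - T%:P)
  - ((N - T - B) * T) *: ('X - T%:P) - (B * T) *: ('X - (T + 2)%:P).
have pE x : p.[x] = (x - (N + T - 2)) * (x - (T + 2)) * (x - T)
    - (N - T - B) * T * (x - T) - B * T * (x - (T + 2)).
  by rewrite /p !hornerE.
have [||th /andP[th1 th2] /rootP] := @poly_ivt _ p (N + 2 * T - 2 - d) (N + 2 * T).
- lra.
- rewrite !pE; apply/andP; split.
    set A := N + T - 4 - d.
    have -> : N + 2 * T - 2 - d - (N + T - 2) = T - d by ring.
    have -> : N + 2 * T - 2 - d - (T + 2) = A by rewrite /A; ring.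
    have -> : N + 2 * T - 2 - d - T = A + 2 by rewrite /A; ring.
    have A0 : 0 <= A by rewrite /A; lra.
    (* The term Nd, at least 125T^2, absorbs everything of lower order. *)
    have h : (T - d) * (A + 2) <= (N - T) * T.
      have dN : 125 * T ^+ 2 <= N * d.
        have -> : 125 * T ^+ 2 = 1000 * T ^+ 3 * d.
          by transitivity (125 * T ^+ 2 * (8 * T * d)); [rewrite dT mulr1|ring].
        by rewrite ler_wpM2r // ltW.
      have : 0 <= T * d by rewrite mulr_ge0; lra.
      have : d * d <= 1 by nra.
      by rewrite /A; lra.
    have := ler_wpM2l A0 h.
    have : 0 <= T * (N - T - B) by rewrite mulr_ge0; lra.
    by lra.
  have -> : N + 2 * T - (N + T - 2) = T + 2 by ring.
  have -> : N + 2 * T - (T + 2) = N + T - 2 by ring.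
  have -> : N + 2 * T - T = N + T by ring.
  have : (N - T) * T <= (N + T - 2) * (T + 2) by apply: ler_pM; lra.
  move=> /(ler_wpM2r (_ : 0 <= N + T)) h; have {}h := h ltac:(lra).
  have : 0 <= B * T by rewrite mulr_ge0; lra.
  by lra.
rewrite pE => root_th; exists th; split; [by []|lra|].
have h1 : th - T - 2 != 0 by rewrite gt_eqF //; lra.
have h2 : th - T != 0 by rewrite gt_eqF //; lra.
apply: (mulIf (mulf_neq0 h1 h2)).
have -> : (N + T - 2 + (N - T - B) * (T / (th - T - 2)) + B * (T / (th - T))) *
    ((th - T - 2) * (th - T)) = (N + T - 2) * (th - T - 2) * (th - T) +
    (N - T - B) * T * (th - T) + B * T * (th - T - 2).
  by field; rewrite h2 h1.
by lra.
Qed.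

(** * Recognising the extremal graph *)

Section ConeIsomorphism.
Local Open Scope nat_scope.

(** Induction on |A|: the two ends of an edge are put in front, which shifts the other indices by 2
    and so keeps equality of halves. When no edge is left, at most one vertex remains. *)
Lemma matching_enumeration (G : sgraph) (A : {set G}) :
  (forall v u u', v \in A -> u \in A -> u' \in A ->
    adj v u -> adj v u' -> u = u') ->
  (#|[set v in A | [forall u, adj v u ==> (u \notin A)]]| <= 1)%N ->
  exists s : seq G, [/\ uniq s, s =i A &
    forall v0 i j, (i < size s)%N -> (j < size s)%N ->
    adj (nth v0 s i) (nth v0 s j) = (i != j) && (i./2 == j./2)].
Proof.
have [m] := ubnP #|A|; elim: m A => // m IH A ltm inj lone.
case: (boolP [exists v in A, exists u in A, adj v u]) => [|none]; last first.
  exists (enum A); split=> [||v0 i j]; [exact: enum_uniq|exact: mem_enum|].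
  have A1 : (#|A| <= 1)%N.
    apply: leq_trans lone; apply: subset_leq_card; apply/subsetP => v vA.
    rewrite inE vA; apply/forallP => u; apply/implyP => vu; apply/negP => uA.
    by case/negP: none; apply/exists_inP; exists v => //; apply/exists_inP; exists u.
  rewrite -cardE => i0 j0; have -> : i = 0%N by lia.
  have -> : j = 0%N by lia.
  by rewrite adj_irrefl.
case/exists_inP => v vA /exists_inP[u uA vu].
have uv : u != v by apply: contraTneq vu => ->; rewrite adj_irrefl.
have v_only x : x \in A -> adj v x -> x = u by move=> xA vx; apply: (inj v).
have u_only x : x \in A -> adj u x -> x = v.
  by move=> xA ux; apply: (inj u) => //; rewrite adj_sym.
pose B := A :\ v :\ u.
have BA x : x \in B -> x \in A by rewrite !inE => /and3P[].
have [|||s [us sB sE]] := IH B.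
- move: ltm; rewrite (cardsD1 v A) vA (cardsD1 u (A :\ v)) !inE uv uA -/B /=; lia.
- by move=> x y z /BA xA /BA yA /BA zA; apply: inj.
- apply: leq_trans lone; apply: subset_leq_card; apply/subsetP => x.
  rewrite [x \in _]inE => /andP[xB /forallP xlone]; rewrite inE (BA _ xB) /=.
  apply/forallP => y; apply/implyP => xy; apply/negP => yA.
  have := xlone y; rewrite xy !inE yA andbT negb_and !negbK /=.
  move: xB; rewrite !inE => /and3P[xu xv xA] /orP[] /eqP e; subst y.
    by case/eqP: xv; apply: u_only => //; rewrite adj_sym.
  by case/eqP: xu; apply: v_only => //; rewrite adj_sym.
have vs : v \notin s by rewrite sB !inE eqxx andbF.
have us' : u \notin s by rewrite sB !inE eqxx.
have far x v0 i : (x == v) || (x == u) -> (i < size s)%N ->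
    adj x (nth v0 s i) = false.
  move=> xvu lti; have := mem_nth v0 lti; rewrite sB !inE.
  move: (nth _ _ _) => y /and3P[yu yv yA]; apply/negP => xy.
  case/orP: xvu => /eqP ex; subst x.
    by case/eqP: yu; apply: v_only.
  by case/eqP: yv; apply: u_only.
exists (v :: u :: s); split.
- by rewrite /= inE eq_sym (negPf uv) vs us' us.
- move=> x; rewrite !inE sB !inE; case: (eqVneq x v) => [->|_]; first by rewrite vA.
  by case: (eqVneq x u) => [->|_]; rewrite ?uA.
move=> v0 [|[|i]] [|[|j]] //= lti ltj; rewrite ?adj_irrefl //.
- by apply: far; rewrite ?eqxx.
- by rewrite adj_sym.
- by apply: far; rewrite ?eqxx ?orbT.
- by rewrite adj_sym; apply: far; rewrite ?eqxx.
- by rewrite adj_sym; apply: far; rewrite ?eqxx ?orbT.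
- by rewrite sE.
Qed.

Lemma cone_giso (G : sgraph) (L : {set G}) : (0 < #|L|)%N -> cone L ->
  (#|unmatched L| <= 1)%N ->
  giso G (join (complete #|L|) (matching (#|G| - #|L|))).
Proof.
move=> L0 [uL inj] lone; have [w wL] := card_gt0P L0.
have [|| s [us sL sE]] := @matching_enumeration G (~: L).
- by move=> v u u'; rewrite !inE; apply: inj.
- apply: leq_trans lone; apply: subset_leq_card; apply/subsetP => v.
  rewrite !inE => /andP[-> /forallP h]; apply/forallP => u.
  by have := h u; rewrite inE negbK.
have szs : size s = (#|G| - #|L|)%N.
  by rewrite -(cardsC L) addKn -(card_uniqP us); apply: eq_card.
apply: giso_sym.
pose g (x : join (complete #|L|) (matching (#|G| - #|L|))) : G :=
  match x with inl i => nth w (enum L) i | inr j => nth w s j end.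
have gl (i : 'I_#|L|) : nth w (enum L) i \in L.
  by rewrite -mem_enum mem_nth // -cardE.
have ltj (j : 'I_(#|G| - #|L|)) : (j < size s)%N by rewrite szs.
have gr (j : 'I_(#|G| - #|L|)) : nth w s j \notin L.
  by have := mem_nth w (ltj j); rewrite sL inE.
have gE_l (i i' : 'I_#|L|) : (nth w (enum L) i == nth w (enum L) i') = (i == i').
  by rewrite nth_uniq ?enum_uniq // -cardE.
have inj_g : injective g.
  move=> [i|j] [i'|j'] /= e.
  - by congr inl; apply/eqP; rewrite -gE_l e.
  - by have := gr j'; rewrite -e gl.
  - by have := gr j; rewrite e gl.
  - by congr inr; apply/val_inj/eqP; rewrite -(nth_uniq w (ltj j) (ltj j')) // e.
exists g.
  apply: inj_card_bij inj_g _.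
  by rewrite card_sum !card_ord subnKC // max_card.
move=> [i|j] [i'|j'] /=.
- rewrite /complete_adj -gE_l; apply/idP/idP => [|ne].
    by apply: contraTneq => ->; rewrite adj_irrefl.
  by apply: uL; rewrite ?gl // eq_sym.
- by apply: uL; [exact: gl|apply: contraNneq (gr j') => ->].
- by rewrite adj_sym; apply: uL; [exact: gl|apply: contraNneq (gr j) => ->].
- by rewrite sE.
Qed.

End ConeIsomorphism.

(** * The extremal graph as a cone *)

Section JoinMatching.
Local Open Scope nat_scope.
Variables t m : nat.
Let H := join (complete t) (matching m).
Let L : {set H} := [set x | if x is inl _ then true else false].

Lemma card_join_left : #|L| = t.
Proof.
rewrite -[RHS]card_ord -(card_imset _ (@inl_inj 'I_t 'I_m)); apply: eq_card.
move=> [i|j]; rewrite !inE; first by rewrite imset_f.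
by apply/esym/negP => /imsetP[].
Qed.

Lemma cone_join_left : cone L.
Proof.
split=> [[i|j] [i'|j']|[i|j] [i'|j'] [i''|j'']]; rewrite !inE //=.
- by move=> _; rewrite /complete_adj eq_sym.
- move=> _ _ _ /andP[n1 /eqP e1] /andP[n2 /eqP e2]; congr inr; apply: val_inj => /=.
  by move: n1 n2 e1 e2; rewrite -!val_eqE /=; lia.
Qed.

Lemma unmatched_join_left : (#|unmatched L| <= 1)%N.
Proof.
have last_only (j : 'I_m) : inr j \in unmatched L -> j = m.-1 :> nat.
  rewrite inE => /andP[_ /forallP h]; apply/eqP; apply: contraT => ne.
  (* This is the partner of [j] in the matching; it could only fall out of range for [j] = m - 1. *)
  have ltk : ((if odd j then j.-1 else j.+1) < m)%N.
    by have := ltn_ord j; case: ifP => _; lia.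
  have := h (inr (Ordinal ltk)); rewrite inE /= implybF /matching_adj.
  by rewrite -val_eqE /=; case: ifP => jo; lia.
apply/card_le1_eqP => [[i|j] [i'|j']]; rewrite ?[inl _ \in _]inE ?[_ \in L]inE //=.
by move=> /last_only e /last_only e'; congr inr; apply: val_inj => /=; rewrite e e'.
Qed.

End JoinMatching.

(** * Structure of graphs attaining the bound, and conclusion *)

Lemma minor_free_subgraph (K G : sgraph) : minor_free K G -> ~ subgraph K G.
Proof.
move=> free sub; apply: free; exists K => //.
by apply: contracts_iso; exists id => //; exists id.
Qed.

Lemma full_degree_adj (G : sgraph) (v u : G) :
  degree v = #|G|.-1 -> u != v -> adj v u.
Proof.
move=> dv uv; have /subset_cardP : #|[pred x | adj v x]| = #|predC1 v|.
  by rewrite cardC1 -dv.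
have sub : [pred x | adj v x] \subset predC1 v.
  by apply/subsetP => x; rewrite !inE; apply: contraTneq => ->; rewrite adj_irrefl.
by move=> /(_ sub)/(_ u); rewrite !inE uv.
Qed.

(** A path u - v - u' outside the core closes through [w] to a quadrangle. The other t - 1 core
    vertices share 3t neighbours with [w], so the greedy choice completes it to Q_t. *)
Lemma dominating_core_cone (G : sgraph) (t : nat) (w : G) :
  ~ subgraph (quads t) G -> #|core t w| = t ->
  (forall u, u \in core t w -> degree u = #|G|.-1) -> cone (core t w).
Proof.
move=> noQ cS full.
have univ v u : v \in core t w -> u != v -> adj v u.
  by move=> /full; apply: full_degree_adj.
split=> // v u u' vS uS u'S vu vu'; apply/eqP/contraT => uu'; case: noQ.
have wS : w \in core t w by rewrite inE eqxx.
have notS x y : x \notin core t w -> y \in core t w -> (y == x) = false.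
  by move=> xS yS; apply/negbTE; apply: contraNneq xS => <-.
have sz : size (enum (core t w :\ w)) = t.-1.
  by rewrite -cardE; have := cardsD1 w (core t w); rewrite wS cS => e; rewrite [in RHS]e.
have t_gt0 : (0 < t)%N by rewrite -cS; apply/card_gt0P; exists w.
have neq (x y : G) : adj x y -> (x == y) = false.
  by move=> e; apply/negP => /eqP xy; rewrite xy adj_irrefl in e.
have notin x : x \notin core t w -> x \notin enum (core t w :\ w).
  by rewrite mem_enum in_setD1 => /negPf ->; rewrite andbF.
have := @extend_petals G w [:: (u, v, u')] (enum (core t w :\ w)).
rewrite sz add1n prednK //; apply.
- rewrite /= !inE mem_enum in_setD1 eqxx /= !(notS _ w) //=.
  by rewrite eq_sym (neq _ _ vu) (negPf uu') (neq _ _ vu') !notin ?enum_uniq.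
- rewrite /= /petal /= vu' [adj u v]adj_sym vu [adj u' w]adj_sym.
  by rewrite !univ // eq_sym notS.
- by move=> x; rewrite mem_enum !inE => /andP[/negPf -> /=].
Qed.

Lemma q_extremal (R : realType) (t : nat) (G : sgraph) : (0 < t)%N ->
  (1000 * t ^ 3 <= #|G|)%N -> ~ subgraph (quads t) G ->
  q R (join (complete t) (matching (#|G| - t))) <= q R G ->
  giso G (join (complete t) (matching (#|G| - t))).
Proof.
move=> t_gt0 n_big noQ; set H := join _ _ => q_ge.
have t3 : (t <= t ^ 3)%N by rewrite -{1}[t]expn1 leq_pexp2l.
have tn : (t <= #|G|)%N by lia.
have cardH : #|H| = #|G| by rewrite card_sum !card_ord subnKC.
pose LH := [set x : H | if x is inl _ then true else false].
have cL : #|LH| = t by apply: card_join_left.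
have lone : (#|unmatched LH| <= 1)%N by apply: unmatched_join_left.
have [|theta [th_ge th_gt thE]] := @cone_row_root R t #|G| #|unmatched LH| t_gt0 n_big.
  by apply: leq_trans lone _; lia.
(* [theta] is an eigenvalue of [H], so its lower bound passes to [q R G] and supplies the estimate
   required on the core. *)
have th_q : theta <= q R G.
  apply: le_trans q_ge; apply: (@cone_q_ge H R LH).
  - exact: cone_join_left.
  - by rewrite cL.
  - by rewrite cL.
  - by rewrite /cone_row cL cardH.
have r_ge := le_trans th_ge th_q.
have [|y [y0 y_neq0 y_sub]] := @q_subeigenvector R G; first by lia.
have t1 : 1 <= t%:R :> R by rewrite ler1n.
have [|||w dw] := exists_large_degree t_gt0 y_neq0 y_sub.
- by lia.
- exact: noQ.
- have : (8 * t%:R)^-1 <= 1 :> R by rewrite invf_le1; lra.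
  by lra.
have cS := card_core w noQ.
have off x : x \notin core t w -> (degree x <= 8 * t)%N by apply: degree_off_core.
have S0 : (0 < #|core t w|)%N by apply/card_gt0P; exists w; rewrite inE eqxx.
have [M [M0 _ [w' w'S yw'] _]] :=
  core_row t_gt0 y0 y_neq0 y_sub cS off S0 n_big r_ge.
have [cSt full] := core_dominating t_gt0 y0 y_neq0 y_sub cS off S0 n_big r_ge.
have coneS := dominating_core_cone noQ cSt full.
rewrite /H -[in complete t]cSt -[in (_ - t)%N]cSt.
(* It remains to see that [G] has no more unmatched vertices than [H]; [theta] solves the equation
   with the count of [H]. *)
apply: cone_giso => //; apply: leq_trans lone.
apply: (@cone_subeigenvector G R (core t w) theta coneS _ (q R G) y) => //.
- by rewrite cSt.
- by exists w'; rewrite // yw'.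
- by rewrite /cone_row cSt.
Qed.

Theorem corollary1p2 (R : realType) (t : nat) (ht : (1 <= t)%N) :
  exists n0 : nat, forall n : nat, (n0 <= n)%N ->
    forall G : sgraph, #|G| = n -> minor_free (quads t) G ->
      (q R G <= q R (join (complete t) (matching (n - t)%N))) /\
      (q R G = q R (join (complete t) (matching (n - t)%N)) <->
       giso G (join (complete t) (matching (n - t)%N))).
Proof.
exists (1000 * t ^ 3)%N => n n_big G cG /minor_free_subgraph noQ; subst n.
have key := @q_extremal R t G ht n_big noQ.
split; last by split=> [e|]; [apply: key; rewrite e|apply: q_giso].
(* A strictly larger value would force an isomorphism, hence equal values. *)
by rewrite leNgt; apply/negP => lt; have := lt; rewrite -(q_giso R (key (ltW lt))) ltxx.
Qed.
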